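(* For any finite connected graph $G$ on $n$ vertices with minimum degree $\delta \geq 23$, the burning number of $G$ is at most $\lceil \sqrt{n}\,\rceil$.
   Context: Graphs are finite, simple, undirected and unweighted; $d(u,v)$ denotes the shortest-path distance. Burning process: it takes place in synchronous rounds $1,2,\dots$. In each round $i$, every vertex having a neighbour that was burned in an earlier round becomes burned, and additionally one chosen vertex $a_i$ (the activator of round $i$) becomes burned; burned vertices stay burned. A burning sequence $\langle a_1,\dots,a_m\rangle$ burns $G$ in $m$ rounds if all vertices are burned by the end of round $m$, equivalently if every vertex $v$ satisfies $d(v,a_i)\le m-i$ for some $i\in\{1,\dots,m\}$. The burning number of $G$ is the minimum $m$ for which there is a burning sequence that burns $G$ in $m$ rounds. *)

(* Defs.v *)
From mathcomp Require Import all_boot.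

Set Implicit Arguments.
Unset Strict Implicit.
Unset Printing Implicit Defensive.

(* A finite simple graph is a symmetric irreflexive adjacency relation
   [e : rel T] on a finite vertex type [T]. *)
Definition simple_graph (T : finType) (e : rel T) : Prop :=
  symmetric e /\ irreflexive e.

Definition connected_graph (T : finType) (e : rel T) : Prop :=
  forall x y : T, connect e x y.

Definition degree (T : finType) (e : rel T) (x : T) : nat :=
  #|[set y | e x y]|.

(* All degrees are at most [#|T|], so the default value [#|T|] plays no role
   unless the graph is empty, in which case the minimum degree is 0. *)
Definition min_degree (T : finType) (e : rel T) : nat :=
  \big[minn/#|T|]_(x : T) degree e x.

(* One round: [B] is the set of vertices burned in earlier rounds and [a] is
   the activator of the round. *)
Definition burn_round (T : finType) (e : rel T) (B : {set T}) (a : T) :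
    {set T} :=
  a |: (B :|: [set v | [exists u in B, e u v]]).

(* The vertices burned at the end of round [size s], with activators [s]. *)
Definition burned (T : finType) (e : rel T) (s : seq T) : {set T} :=
  foldl (burn_round e) set0 s.

Definition burns_in (T : finType) (e : rel T) (m : nat) : bool :=
  [exists s : m.-tuple T, burned e s == [set: T]].

Lemma ex_burns_in (T : finType) (e : rel T) : exists m, burns_in e m.
Proof.
have sub s (B : {set T}) x : (x \in B) || (x \in s) ->
    x \in foldl (burn_round e) B s.
  elim: s B => [|a s IHs] B /=; first by rewrite orbF.
  rewrite in_cons => /or3P[xB | xa | xs]; apply: IHs;
    by rewrite ?xs ?orbT // /burn_round !inE ?xB ?xa ?orbT.
exists (size (enum T)); apply/existsP; exists (in_tuple (enum T)).
by apply/eqP/setP=> x; rewrite inE sub // mem_enum orbT.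
Qed.

Definition burning_number (T : finType) (e : rel T) : nat :=
  ex_minn (ex_burns_in e).

(* Main.v *)
(* Grow a walk [w] greedily: while some vertex lies at distance at least 3
   from [w], connectivity yields a vertex [v] at distance exactly 3, and a
   detour of 6 steps from [w] to [v] and back puts [v] on the walk. The closed
   neighbourhood of [v] is disjoint from that of [w], so every 6 steps cost
   [delta + 1 >= 24] new vertices. The final walk has at most [n / 4 - 5]
   vertices, which is at most [(m - 2)^2] when [n <= m^2]. Cut it into blocks
   of 2(m-3)+1, ..., 3, 1 vertices and activate their centres: the first [m - 2]
   rounds burn the walk by round [m - 2], and two more rounds burn everything
   within distance 2 of it. *)
Require Import Defs.
From HB Require Import structures.
From mathcomp Require Import all_boot all_order all_algebra.
From mathcomp Require Import zify.

Import Order.TTheory GRing.Theory Num.Theory.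

Section Burning.

Variables (T : finType) (e : rel T).
Implicit Types (A B : {set T}) (s w : seq T).

Definition closed_nbhd A : {set T} := A :|: [set v | [exists u in A, e u v]].

Lemma closed_nbhdP A v :
  reflect (v \in A \/ exists2 u, u \in A & e u v) (v \in closed_nbhd A).
Proof.
rewrite !inE; apply: (iffP orP) => -[vA|]; [by left| |by left|].
  by case/existsP=> u /andP[]; right; exists u.
by case=> u uA euv; right; apply/existsP; exists u; rewrite uA.
Qed.

Lemma closed_nbhdS A B : A \subset B -> closed_nbhd A \subset closed_nbhd B.
Proof.
move=> /subsetP sAB; apply/subsetP=> v /closed_nbhdP[vA|[u uA euv]].
  by apply/closed_nbhdP; left; apply: sAB.
by apply/closed_nbhdP; right; exists u => //; apply: sAB.
Qed.

Lemma sub_closed_nbhd A : A \subset closed_nbhd A.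
Proof. exact: subsetUl. Qed.

Lemma iter_closed_nbhdS k A B :
  A \subset B -> iter k closed_nbhd A \subset iter k closed_nbhd B.
Proof. by move=> sAB; elim: k => //= k; apply: closed_nbhdS. Qed.

Lemma iter_closed_nbhd_leq k l A :
  k <= l -> iter k closed_nbhd A \subset iter l closed_nbhd A.
Proof.
move=> /subnK <-; elim: (l - k) => //= i IHi.
exact: subset_trans IHi (sub_closed_nbhd _).
Qed.

(** Whatever the activator, a round burns at least the closed neighbourhood of what was burned
    before. *)
Lemma sub_foldl_burn_round B s :
  iter (size s) closed_nbhd B \subset foldl (burn_round e) B s.
Proof.
elim: s B => //= a s IHs B; rewrite -iterS iterSr.
apply: subset_trans (IHs _); apply/iter_closed_nbhdS/subsetUr.
Qed.

Lemma nth_walk_forward x0 w i k : sorted e w -> i + k < size w ->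
  nth x0 w (i + k) \in iter k closed_nbhd [set nth x0 w i].
Proof.
move=> /(sortedP x0) we; elim: k => [|k IHk] lt_ik; first by rewrite addn0 set11.
rewrite iterS; apply/closed_nbhdP; right; exists (nth x0 w (i + k)).
  by apply: IHk; lia.
by rewrite addnS; apply: we; lia.
Qed.

Hypothesis sym_e : symmetric e.

Lemma nth_walk_backward x0 w i k : sorted e w -> i + k < size w ->
  nth x0 w i \in iter k closed_nbhd [set nth x0 w (i + k)].
Proof.
move=> /(sortedP x0) we.
elim: k i => [|k IHk] i lt_ik; first by rewrite addn0 set11.
rewrite iterS; apply/closed_nbhdP; right; exists (nth x0 w i.+1).
  by rewrite -addSnnS; apply: IHk; lia.
by rewrite sym_e; apply: we; lia.
Qed.

Lemma nth_walk_dist x0 w i j k : sorted e w -> i < size w -> j < size w ->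
  i <= j + k -> j <= i + k ->
  nth x0 w i \in iter k closed_nbhd [set nth x0 w j].
Proof.
move=> we ltiw ltjw lei lej; case: (leqP i j) => ij.
  apply: (subsetP (@iter_closed_nbhd_leq (j - i) _ _ _)); first by lia.
  by have := @nth_walk_backward x0 w i (j - i) we; rewrite subnKC //; apply.
apply: (subsetP (@iter_closed_nbhd_leq (i - j) _ _ _)); first by lia.
have := @nth_walk_forward x0 w j (i - j) we; rewrite subnKC; last exact: ltnW.
exact.
Qed.

(** With [k.+1] rounds left, the first activator still spreads for [k] rounds and so covers a block
    of [2k + 1] vertices; at most [(k + 1)^2 - (2k + 1) = k^2] remain. [B] is arbitrary so that the
    induction can restart from the set already burned. *)
Lemma burn_walk (x0 : T) k B w : sorted e w -> size w <= k ^ 2 ->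
  exists2 s, size s = k & {subset w <= foldl (burn_round e) B s}.
Proof.
elim: k B w => [|k IHk] B w we szw.
  by exists [::] => //; case: w szw {we}.
(* The centre of the block, or the last vertex if the walk is too short to reach it. For an empty
   walk [c] is the default [x0], which is harmless. *)
pose l := k.*2.+1; pose i0 := minn k (size w).-1; pose c := nth x0 w i0.
have [|s szs ws] := IHk (burn_round e B c) (drop l w) (drop_sorted l we).
  by rewrite size_drop /l; nia.
exists (c :: s) => /= [|x]; first by rewrite szs.
rewrite -{1}(cat_take_drop l w) mem_cat => /orP[/(nthP x0)[i]|/ws //].
rewrite size_take_min leq_min => /andP[ltil ltiw]; rewrite nth_take // => <-.
apply: (subsetP (sub_foldl_burn_round _ _)); rewrite szs.
have /subsetP : iter k closed_nbhd [set c] \subset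
    iter k closed_nbhd (burn_round e B c).
  by apply: iter_closed_nbhdS; rewrite sub1set !inE eqxx.
apply; apply: nth_walk_dist => //; move: ltil; rewrite /i0 /l.
all: by case: (size w) ltiw => //= p; lia.
Qed.

Lemma burns_in_walk (x0 : T) k w : sorted e w -> size w <= k ^ 2 ->
  iter 2 closed_nbhd [set x in w] = setT -> burns_in e k.+2.
Proof.
move=> we szw cov; have [s szs ws] := burn_walk x0 k set0 w we szw.
(* The last two rounds only spread the fire, so their activators are arbitrary. *)
have szt : size (s ++ [:: x0; x0]) == k.+2 by rewrite size_cat szs /= addn2.
apply/existsP; exists (Tuple szt); rewrite -subTset /burned foldl_cat.
apply: subset_trans (sub_foldl_burn_round _ [:: x0; x0]).
rewrite -cov; apply: iter_closed_nbhdS; apply/subsetP=> x; rewrite inE.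
exact: ws.
Qed.

Lemma card_closed_nbhd1 x : irreflexive e ->
  #|closed_nbhd [set x]| = (degree e x).+1.
Proof.
move=> irr_e; have -> : closed_nbhd [set x] = x |: [set y | e x y].
  apply/setP=> y; apply/closed_nbhdP/setU1P; rewrite !inE.
    by case=> [/eqP|[u /set1P-> ]]; [left|right].
  by case=> [/eqP|exy]; [left|right; exists x; rewrite ?inE].
by rewrite cardsU1 inE irr_e.
Qed.

Hypothesis connected_e : connected_graph e.

Lemma exit_edge A x : x \in A -> A != setT ->
  exists2 u, u \in A & exists2 v, v \notin A & e u v.
Proof.
move=> xA; rewrite -subTset => /subsetPn[y _ yA].
have /connectP[p] := connected_e x y.
elim: p x xA => [|z p IHp] x xA /= => [_ eyx|/andP[exz ep] ly].
  by rewrite eyx xA in yA.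
by have [zA|zA] := boolP (z \in A); [apply: IHp ly|exists x => //; exists z].
Qed.

(** After an occurrence of [a], insert [x, y, v, y, x, a]: back at [a], the walk goes on as before.
    Repeated vertices are allowed. *)
Lemma walk_detour w a x y v : sorted e w -> a \in w ->
    e a x -> e x y -> e y v ->
  exists w', [/\ sorted e w', size w' = size w + 6 &
                 {subset v :: w <= w'}].
Proof.
move=> we aw eax exy eyv; move: we; case/splitPr: aw => p q.
rewrite -[a :: q]cat1s catA cats1 => we.
exists (rcons p a ++ [:: x; y; v; y; x; a] ++ q); split.
- move: we; case: p => [|b p] /=.
    by rewrite eax exy eyv -sym_e eyv -sym_e exy -sym_e eax.
  rewrite !cat_path => /andP[-> ]; rewrite last_rcons /=.
  by rewrite eax exy eyv -sym_e eyv -sym_e exy -sym_e eax.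
- by rewrite !size_cat /=; lia.
move=> z; rewrite !(inE, mem_cat).
by case/or3P=> [->|->|->]; rewrite ?orbT.
Qed.

Lemma distance2_dominating_walk (x0 : T) d : irreflexive e ->
    (forall x, d <= degree e x) ->
  exists w, [/\ sorted e w, d.+1 * (size w + 5) <= 6 * #|T| &
                iter 2 closed_nbhd [set x in w] = setT].
Proof.
move=> irr_e le_d.
(* The 5 makes the invariant fit the one-vertex walk, since [1 + 5 = 6]. It also forces
   [size w + 5 <= 6 * #|T|], which excludes the second alternative; that alternative serves as fuel
   for the induction. *)
suff [w [_ we inv [cov|gt_w]]] : exists w, [/\ x0 \in w, sorted e w,
    d.+1 * (size w + 5) <= 6 * #|closed_nbhd [set x in w]| &
    iter 2 closed_nbhd [set x in w] = setT \/ 6 * #|T| < size w].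
- exists w; split=> //; apply: leq_trans inv _.
  by rewrite leq_mul2l max_card.
- have : #|closed_nbhd [set x in w]| <= #|T| by exact: max_card.
  by have := leq_pmull (size w + 5) (ltn0Sn d); lia.
elim: (6 * #|T|) => [|k [w [x0w we inv [cov|gt_w]]]]; last 2 first.
- by exists w; split=> //; left.
- have [cov|ncov] := eqVneq (iter 2 closed_nbhd [set x in w]) setT.
    by exists w; split=> //; left.
  have x0in : x0 \in iter 2 closed_nbhd [set x in w].
    apply: (subsetP (@iter_closed_nbhd_leq 0 2 _ _)) => //=.
    by rewrite inE.
  have [y yN2 [v vN2 eyv]] := exit_edge _ _ x0in ncov.
  (* Trace [y] back to the walk: a shorter way than [a, x, y] would put [v] within distance 2. *)
  have /closed_nbhdP[yN1|[x xN1 exy]] := yN2.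
    by case/closed_nbhdP: vN2; right; exists y.
  have /closed_nbhdP[xw|[a]] := xN1.
    case/closed_nbhdP: vN2; right; exists y => //.
    by apply/closed_nbhdP; right; exists x.
  rewrite inE => aw eax.
  have [w' [we' szw' sw']] := walk_detour w a x y v we aw eax exy eyv.
  exists w'; split=> //; first by apply: sw'; rewrite inE x0w orbT.
  + have dis : [disjoint closed_nbhd [set x in w] & closed_nbhd [set v]].
      apply/pred0P=> z /=; apply/negP=> /andP[zw].
      case/closed_nbhdP=> [/set1P zv|[u /set1P-> evz]]; case/closed_nbhdP: vN2.
        by left; rewrite -zv.
      by right; exists z; rewrite // sym_e.
    have sub : closed_nbhd [set x in w] :|: closed_nbhd [set v] \subset
        closed_nbhd [set x in w'].
      rewrite subUset !closed_nbhdS // ?sub1set ?inE ?sw' ?inE ?eqxx //.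
      by apply/subsetP=> z; rewrite !inE => zw; apply: sw'; rewrite inE zw orbT.
    have := subset_leq_card sub; rewrite cardsU disjoint_setI0 // cards0 subn0.
    by rewrite card_closed_nbhd1 // szw'; have := le_d v; nia.
  + by right; lia.
exists [:: x0]; split=> //=; first by rewrite inE.
  have -> : [set x in [:: x0]] = [set x0] by apply/setP=> z; rewrite !inE.
  by rewrite card_closed_nbhd1 //; have := le_d x0; nia.
by right.
Qed.

End Burning.

Lemma min_degree_le (T : finType) (e : rel T) x : min_degree e <= degree e x.
Proof.
rewrite /min_degree; have := mem_index_enum x.
elim: (index_enum T) => //= y r IHr; rewrite big_cons in_cons geq_min.
by case/predU1P=> [->|/IHr ->]; rewrite ?leqnn ?orbT.
Qed.

Lemma burning_number_sqr (T : finType) (e : rel T) m :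
    simple_graph e -> connected_graph e -> 23 <= min_degree e ->
  #|T| <= m ^ 2 -> burning_number e <= m.
Proof.
move=> [sym_e irr_e] conn_e deg_e le_n.
rewrite /burning_number; case: ex_minnP => b _; apply.
have [x0 _|T0] := pickP (mem T); last first.
  (* On an empty graph the minimum degree is the default [#|T| = 0], below 23. *)
  by move: deg_e; rewrite /min_degree big_pred0 ?(eq_card0 T0) // => y;
    apply: T0.
have le_d x : 23 <= degree e x := leq_trans deg_e (min_degree_le T e x).
have [w [we szw cov]] := distance2_dominating_walk T e sym_e conn_e x0 23 irr_e le_d.
have: 4 * (size w + 5) <= m ^ 2 by lia.
(* The bound forces [m^2 >= 20], so [m = k + 2]. Then [size w <= k^2] because
   [4(m - 2)^2 + 20 - m^2 = 3m^2 - 16m + 36] has negative discriminant. *)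
case: m {le_n} => [|[|k]] le_w; [by nia|by nia|].
by apply: burns_in_walk cov => //; nia.
Qed.

Local Open Scope ring_scope.

Theorem corollary1 (R : archiRcfType) (T : finType) (e : rel T)
    (simple_e : simple_graph e) (connected_e : connected_graph e)
    (min_degree_e : (23 <= min_degree e)%N) :
  (burning_number e)%:Z <= Num.ceil (Num.sqrt (#|T|%:R : R)).
Proof.
have := Num.Theory.ceil_ge (Num.sqrt (#|T|%:R : R)).
(* Nonnegativity lets the integer ceiling be replaced by a natural number [m]; squaring
   [sqrt n <= m] then gives [n <= m^2]. *)
have : 0 <= Num.ceil (Num.sqrt (#|T|%:R : R)).
  rewrite -(ler_int R); apply: le_trans (Num.Theory.ceil_ge _).
  exact: sqrtr_ge0.
case: (Num.ceil _) => // m _ le_m; rewrite lez_nat.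
apply: burning_number_sqr => //.
by rewrite -(ler_nat R) natrX -[X in X <= _]sqr_sqrtr ?ler0n // lerXn2r
  ?nnegrE ?sqrtr_ge0 ?ler0n.
Qed.
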